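(* For every directed graph $G$ and all $S,R\in \mathrm{Mod}(G)$, one has $A^-_G[S]=A^-_G[R]$.
   Context: A graph is a directed graph $G=\langle G,A_G\rangle$ with vertex set $G$ (loops allowed, $G$ possibly infinite) and $A_G\subseteq G\times G$. For $x\in G$ put $A_G(x)=\{y\in G\mid (x,y)\in A_G\}$ and $A^-_G(x)=\{y\in G\mid x\in A_G(y)\}$. For $X\subseteq G$ put $A_G(X)=\bigcup_{x\in X}A_G(x)$, $A^-_G(X)=\bigcup_{x\in X}A^-_G(x)$ and $A^-_G[X]=X\cup A^-_G(X)$. A semikernel of $G$ is a set $S\subseteq G$ such that $A_G(S)\subseteq A^-_G(S)\subseteq G\setminus S$; $SK(G)$ denotes the set of all semikernels of $G$. $\mathrm{Mod}(G)$ is the set of all $S\in SK(G)$ such that (i) $A^-_G(A^-_G[S])\subseteq A^-_G[S]$, and (ii) there is no $R\in SK(G)$ with $A^-_G(A^-_G[R])\subseteq A^-_G[R]$ and $A^-_G[S]\subsetneq A^-_G[R]$. *)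

(* Defs.v *)
From mathcomp Require Import all_boot.
From mathcomp Require Import classical_sets.

Set Implicit Arguments.
Unset Strict Implicit.
Unset Printing Implicit Defensive.

Local Open Scope classical_set_scope.

Record digraph := Digraph {
  vertex :> Type;
  arcs : set (vertex * vertex)
}.

Section Digraph.
Variable G : digraph.
Implicit Types (x : G) (X S R : set G).

(* In the notation A_G for the arc relation: outN x = A_G(x), inN x = A^-_G(x),
   outNs X = A_G(X), inNs X = A^-_G(X) and cinNs X = A^-_G[X]. *)
Definition outN x : set G := [set y | arcs (x, y)].
Definition inN x : set G := [set y | outN y x].

Definition outNs X : set G := \bigcup_(x in X) outN x.
Definition inNs X : set G := \bigcup_(x in X) inN x.
Definition cinNs X : set G := X `|` inNs X.

Definition semikernel : set (set G) :=
  [set S | outNs S `<=` inNs S /\ inNs S `<=` ~` S].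

Definition Mod : set (set G) :=
  [set S | [/\ semikernel S,
     inNs (cinNs S) `<=` cinNs S &
     ~ exists R, [/\ semikernel R,
         inNs (cinNs R) `<=` cinNs R &
         cinNs S `<` cinNs R]]].

End Digraph.

(* Main.v *)
Require Import Defs.
From mathcomp Require Import all_boot.
From mathcomp Require Import classical_sets.
From mathcomp Require boolp.

(** If [S] and [R] are semikernels whose closed in-neighbourhoods [A^-[S]] and
    [A^-[R]] are closed under predecessors, then [T = S ∪ (R \ A^-[S])] is again
    a semikernel, and [A^-[T] = A^-[S] ∪ A^-[R]] is closed under predecessors.
    Maximality of [A^-[S]] then forces [A^-[R] ⊆ A^-[S]]. *)

Local Open Scope classical_set_scope.

Section SemikernelUnion.
Variables (G : digraph) (S R : set G).
Hypotheses (skS : semikernel S) (skR : semikernel R).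
Hypothesis closedS : inNs (cinNs S) `<=` cinNs S.

Let T := S `|` (R `\` cinNs S).

Lemma cinNs_predecessor (x y : G) : arcs (x, y) -> cinNs S y -> cinNs S x.
Proof. by move=> xy Sy; apply: closedS; exists y. Qed.

Lemma semikernel_union : semikernel T.
Proof.
have [outS inS] := skS; have [outR inR] := skR.
split=> [y [x [Sx|[Rx nSx]] xy]|y [t Tt yt] Ty].
- have [s Ss ys] : inNs S y by apply: outS; exists x.
  by exists s => //; left.
- have [r Rr yr] : inNs R y by apply: outR; exists x.
  (* If [r] were in [cinNs S], closure under predecessors would pull [y] and then [x] into it along
     [x -> y -> r]; so the witness [r] survives the removal. *)
  exists r => //; right; split=> // Sr.
  by apply: nSx; apply: (cinNs_predecessor _ _ xy); apply: (cinNs_predecessor _ _ yr).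
- case: Tt => [St|[Rt nSt]].
    have yS : inNs S y by exists t.
    by case: Ty => [Sy|[_ nSy]]; [exact: (inS y yS)|apply: nSy; right].
  case: Ty => [Sy|[Ry _]].
    (* An arc from [S] to [t] makes [t] a successor of [S], hence also a predecessor of [S]. *)
    by apply: nSt; right; apply: outS; exists y.
  by apply: (inR y) => //; exists t.
Qed.

(** Removing [cinNs S] from [R] loses nothing: removed vertices and, by closure, their predecessors
    already lie in [cinNs S]. *)
Lemma cinNs_union : cinNs T = cinNs S `|` cinNs R.
Proof.
apply/seteqP; split=> x.
  case=> [[Sx|[Rx _]]|[t [St|[Rt _]] xt]].
  - by left; left.
  - by right; left.
  - by left; right; exists t.
  - by right; right; exists t.
have [Sx _|nSx] := boolp.pselect (cinNs S x).
  case: Sx => [Sx|[s Ss xs]]; first by left; left.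
  by right; exists s => //; left.
case=> // -[Rx|[r Rr xr]]; first by left; right.
right; exists r => //; right; split=> // Sr.
exact/nSx/(cinNs_predecessor _ _ xr).
Qed.

End SemikernelUnion.

(** Upgrades maximal to largest, so the sets of two members of [Mod] contain each other. *)
Lemma Mod_max (G : digraph) (S R : set G) : Mod S -> semikernel R ->
  inNs (cinNs R) `<=` cinNs R -> cinNs R `<=` cinNs S.
Proof.
move=> [skS clS maxS] skR clR; apply: boolp.contrapT => nRS; apply: maxS.
exists (S `|` (R `\` cinNs S)); rewrite cinNs_union //; split.
- exact: semikernel_union.
- move=> x [y [Sy|Ry] xy]; [left; apply: clS|right; apply: clR];
  by exists y.
- split=> [|sub]; last by apply: nRS => x Rx; apply: sub; right.
  by move=> x Sx; left.
Qed.

Theorem theorem3p10 (G : digraph) (S R : set G)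
  (hS : Mod S) (hR : Mod R) : cinNs S = cinNs R.
Proof.
have [skS clS _] := hS; have [skR clR _] := hR.
by apply/seteqP; split; apply: Mod_max.
Qed.
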